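(* Let $\mathcal{C}$ be an irredundant covering of $\mathbb{Z}^2$ by lattices. If the least common multiple of the indices $[\mathbb{Z}^2:L]$ of the lattices $L\in\mathcal{C}$ has prime factorization $\prod_{i=1}^{t}p_i^{e_i}$ (with distinct primes $p_i$ and $e_i\ge1$), then the number of lattices in $\mathcal{C}$ is at least $$t+1+\sum_{i=1}^{t}e_i(p_i-1).$$
   Context: A lattice is a subgroup of $\mathbb{Z}^2$ of finite index. A covering (of $\mathbb{Z}^2$) is a finite collection (set) $\mathcal{C}$ of lattices whose union is $\mathbb{Z}^2$. A covering is irredundant if no proper subset of it is a covering. *)

(* Defs.v *)
From mathcomp Require Import all_boot all_order all_algebra.
From mathcomp Require Import finmap.
From mathcomp Require Import boolp classical_sets functions cardinality.

Set Implicit Arguments.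
Unset Strict Implicit.
Unset Printing Implicit Defensive.

Import GRing.Theory.

Local Open Scope classical_set_scope.
Local Open Scope ring_scope.

Notation Z2 := (int * int)%type.

Definition cosets (L : set Z2) : set (set Z2) :=
  [set [set x + y | y in L] | x in [set: Z2]].

(* Junk value 0 when [cosets L] is infinite. *)
Definition lattice_index (L : set Z2) : nat := #|` fset_set (cosets L)|%fset.

Definition lattice (L : set Z2) : Prop :=
  zmod_closed [in L] /\ finite_set (cosets L).

Definition covering (C : {fset set Z2}) : Prop :=
  (forall L, L \in C -> lattice L) /\
  \bigcup_(L in [set` C]) L = [set: Z2].

Definition irredundant_covering (C : {fset set Z2}) : Prop :=
  covering C /\ forall D : {fset set Z2}, (D `<` C)%fset -> ~ covering D.

(* Main.v *)
(* If x lies outside a lattice L, so does the primitive vector on the line of x,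
   hence only primitive vectors need to be covered.  For a prime p, primitive
   vectors up to p-adic units form the tree P^1(Z_p), whose root has p + 1
   children and whose other nodes have p children each, and a lattice of index
   p^j containing a primitive vector is the set of branches through one node of
   depth j: the determinant of two of its vectors is divisible by p^j.  So at the
   root any p lattices, and at each later level any p - 1 lattices, can be
   avoided by choosing the next digit suitably.

   Give each p_i accordingly p_i tokens at level 0 and p_i - 1 tokens at each of
   the levels 1, ..., e_i - 1, that is 1 + e_i (p_i - 1) tokens, and join a
   lattice L to the tokens of level < v_{p_i}([Z^2 : L]).  As in Tarsi's lemma on
   minimally unsatisfiable formulas, if there are at least as many tokens as
   lattices, a proper subfamily D of maximal deficiency leaves by Hall's theorem
   a matching of the other lattices into tokens not joined to D.  By
   irredundancy some primitive vector avoids D; its digits not seen by D can be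
   changed so as to avoid the other lattices too. *)

Require Import Defs.
From mathcomp Require Import all_boot all_order all_algebra.
From mathcomp Require Import finmap.
From mathcomp Require Import boolp classical_sets functions cardinality.
From mathcomp Require Import zify ring.

Set Implicit Arguments.
Unset Strict Implicit.
Unset Printing Implicit Defensive.

Import Order.TTheory GRing.Theory Num.Theory.

(** * Hall's marriage theorem and sets of maximal deficiency *)

Section Hall.
(* classical_sets shadows the names of many finset lemmas. *)
Import mathcomp.boot.fintype mathcomp.boot.finset.
Variables (S T : finType) (t0 : T).
Implicit Types (A B : {set S}) (N : S -> {set T}).

Definition nbhd N A := \bigcup_(s in A) N s.

Lemma nbhdU N A B : nbhd N (A :|: B) = nbhd N A :|: nbhd N B.
Proof. by rewrite /nbhd bigcup_setU. Qed.

Lemma nbhd0 N : nbhd N set0 = set0.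
Proof. by rewrite /nbhd big_set0. Qed.

Lemma nbhdD N A (X : {set T}) : nbhd (fun s => N s :\: X) A = nbhd N A :\: X.
Proof.
apply/setP=> y; rewrite inE; apply/bigcupP/andP.
  by case=> s sA; rewrite inE => /andP[yX yN]; split=> //; apply/bigcupP; exists s.
by case=> yX /bigcupP[s sA yN]; exists s => //; rewrite inE yX.
Qed.

Lemma card_setUD (X Y : {set T}) : #|X :|: Y| = #|X| + #|Y :\: X|.
Proof. by rewrite cardsU cardsD setIC -addnBA // subset_leq_card // subsetIl. Qed.

(** Induction on [#|A|]. If some nonempty proper [B] has no more neighbours than elements, [B] and
    [A :\: B] are matched separately, the latter outside [nbhd N B]. Otherwise every nonempty proper
    subset has a neighbour to spare, so one pair [s0], [t] may be removed. *)
Lemma hall_marriage N A :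
  (forall B, B \subset A -> #|B| <= #|nbhd N B|) ->
  exists f : S -> T, {in A &, injective f} /\ {in A, forall s, f s \in N s}.
Proof.
have [n] := ubnP #|A|; elim: n N A => // n IH N A; rewrite ltnS => ltAn hall.
have [->|[s0 s0A]] := set_0Vmem A.
  by exists (fun=> t0); split=> [x y|x]; rewrite inE.
have glue (X : {set T}) B (f g : S -> T) : B \subset A ->
    {in B &, injective f} -> {in B, forall s, f s \in N s} ->
    {in A :\: B &, injective g} -> {in A :\: B, forall s, g s \in N s :\: X} ->
    {in B, forall s, f s \in X} ->
    exists f : S -> T, {in A &, injective f} /\ {in A, forall s, f s \in N s}.
  move=> BA injf fN injg gN fX; exists (fun s => if s \in B then f s else g s).
  have disj x y : x \in B -> y \in A :\: B -> f x <> g y.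
    by move=> xB /gN + E; rewrite -E inE fX.
  split=> [x y xA yA|x xA]; last first.
    case: ifPn => [/fN //|xB]; have := gN x; rewrite !inE xB xA => /(_ isT).
    by case/andP.
  case: ifPn => xB; case: ifPn => yB.
  - exact: injf.
  - by move=> E; case: (@disj x y) => //; rewrite inE yB.
  - by move=> E; case: (@disj y x) => //; rewrite inE xB.
  - by apply: injg; rewrite inE ?xB ?yB.
have [[B [BA [B0 [BnA tightB]]]]|slack] :=
    pselect (exists B, B \subset A /\ B != set0 /\ B != A /\ #|nbhd N B| <= #|B|).
  have BpA : B \proper A by rewrite properEneq BnA.
  have [||f [injf fN]] := IH N B.
  - exact: leq_trans (proper_card BpA) _.
  - by move=> E EB; apply: hall; apply: subset_trans EB BA.
  have [||g [injg gN]] := IH (fun s => N s :\: nbhd N B) (A :\: B).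
  - apply: leq_trans ltAn.
    by rewrite -[X in _ < X](cardsID B A) (setIidPr BA) addnC -addn1 leq_add2l card_gt0.
  - move=> E; rewrite subsetD => /andP[EA dEB]; rewrite nbhdD.
    have := hall (B :|: E); rewrite subUset EA BA => /(_ isT).
    rewrite nbhdU card_setUD => h.
    have := leq_trans h (leq_add tightB (leqnn _)).
    move: dEB; rewrite disjoint_sym -leq_card_setU => /eqP ->.
    by rewrite leq_add2l.
  apply: (glue (nbhd N B) B f g) => // s sB.
  by apply/bigcupP; exists s => //; apply: fN.
have [t tN] : exists t, t \in N s0.
  have := hall [set s0]; rewrite sub1set s0A cards1 => /(_ isT).
  by rewrite /nbhd big_set1 card_gt0 => /set0Pn.
have [||g [injg gN]] := IH (fun s => N s :\ t) (A :\ s0).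
- by apply: leq_trans ltAn; rewrite [X in _ < X](cardsD1 s0) s0A.
- move=> E EA; rewrite nbhdD; have [->|E0] := eqVneq E set0; first by rewrite cards0.
  have : #|E| < #|nbhd N E|.
    rewrite ltnNge; apply/negP=> le; apply: slack; exists E; split; last split=> //.
      exact: subset_trans EA (subsetDl _ _).
    split=> //; apply: contraTneq s0A => <-; have /subsetP/(_ s0) := EA.
    by rewrite !inE eqxx; case: (s0 \in E) => // /(_ isT).
  by rewrite (cardsD1 t (nbhd N E)); case: (t \in _) => [h|/ltnW //]; exact: h.
apply: (glue [set t] [set s0] (fun=> t) g) => //.
- by rewrite sub1set.
- by move=> x y; rewrite !inE => /eqP -> /eqP ->.
- by move=> x; rewrite inE => /eqP ->.
- by move=> x _; rewrite inE.
Qed.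

(** For [D] of maximal deficiency, a set [B] outside [D] violating Hall's condition for the
    neighbours not in [nbhd N D] would make [D :|: B] more deficient. *)
Lemma deficient_set_matching N :
  S -> #|S| <= #|nbhd N setT| ->
  exists (D : {set S}) (f : S -> T), [/\ D != setT, {in ~: D &, injective f} &
    {in ~: D, forall s, f s \in N s :\: nbhd N D}].
Proof.
(* [w D] is the deficiency [#|D| - #|nbhd N D|] shifted by [#|T|], which avoids truncated
   subtraction. *)
move=> s0 leST; pose w (D : {set S}) := #|D| + #|~: nbhd N D|.
have P0 : set0 != [set: S] by apply/eqP=> /setP/(_ s0); rewrite !inE.
case: (@arg_maxnP _ set0 (fun D => D != setT) w P0) => D DnT Dmax.
(* By [leST] the maximum over proper subsets is a maximum over all subsets; this matters when
   [D :|: B] is everything. *)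
have wT : w setT <= w set0.
  by rewrite /w nbhd0 setC0 cardsT cards0 add0n cardsT -(cardsC (nbhd N setT)) leq_add2r.
have {}Dmax E : w E <= w D.
  have [->|/Dmax //] := eqVneq E setT; exact: leq_trans wT (Dmax _ P0).
have [B|f [injf fN]] := @hall_marriage (fun s => N s :\: nbhd N D) (~: D); last first.
  by exists D, f.
rewrite -disjoints_subset disjoint_sym -leq_card_setU => /eqP cDB.
have := Dmax (D :|: B); rewrite /w cDB -addnA leq_add2l nbhdU nbhdD.
rewrite -(leq_add2r (#|nbhd N D :|: nbhd N B|)) -addnA [X in _ + X]addnC cardsC.
rewrite card_setUD addnA [#|~: _| + _]addnC cardsC addnC leq_add2l => h; exact: h.
Qed.

End Hall.

(** * Bases, indices and determinants of lattices *)

Section Lattice.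
Local Open Scope ring_scope.
Implicit Types (u v w : Z2) (L : set Z2).

Definition det2 u v : int := u.1 * v.2 - u.2 * v.1.

Lemma fst_mulrz v k : (v *~ k).1 = v.1 * k.
Proof.
have nat n : (v *+ n).1 = v.1 *+ n by elim: n => // n IH; rewrite !mulrS /= IH.
by rewrite -[in RHS](intz k) mulrzr; case: k => n; rewrite ?NegzE ?mulrNz /= nat.
Qed.

Lemma snd_mulrz v k : (v *~ k).2 = v.2 * k.
Proof.
have nat n : (v *+ n).2 = v.2 *+ n by elim: n => // n IH; rewrite !mulrS /= IH.
by rewrite -[in RHS](intz k) mulrzr; case: k => n; rewrite ?NegzE ?mulrNz /= nat.
Qed.

Lemma fst_mulrn v n : (v *+ n).1 = v.1 * n.
Proof. by rewrite pmulrn fst_mulrz. Qed.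

Lemma snd_mulrn v n : (v *+ n).2 = v.2 * n.
Proof. by rewrite pmulrn snd_mulrz. Qed.

Lemma Z2_ext u v : u.1 = v.1 -> u.2 = v.2 -> u = v.
Proof. by case: u v => [? ?] [? ?] /= -> ->. Qed.

(** Take the least positive integer satisfying [P]: remainders modulo it satisfy [P] too and are
    smaller, hence zero. *)
Lemma min_multiple (P : int -> Prop) :
  (exists2 m : nat, (0 < m)%N & P m) -> (forall x y, P x -> P y -> P (x - y)) ->
  exists a : nat, [/\ (0 < a)%N, P a & forall x, P x -> (a %| x)%Z].
Proof.
move=> [m m0 Pm] PB.
have ex : exists n, (0 < n)%N && `[< P (Posz n) >] by exists m; rewrite m0; apply/asboolP.
case: (ex_minnP ex) => a /andP[a0 /asboolP Pa] amin; exists a; split=> // x Px.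
have P0 : P 0 by rewrite -(subrr (Posz a)); apply: (PB).
have PM k : P (Posz a *~ k).
  have nat n : P (Posz a *+ n).
    elim: n => [|n IH]; rewrite ?mulr0n // mulrS -[X in _ + X]opprK; apply: (PB) => //.
    by rewrite -sub0r; apply: (PB).
  case: k => n; first exact: nat.
  by rewrite NegzE mulrNz -sub0r; apply: (PB) => //; apply: nat.
have Pr : P (x %% a)%Z.
  have -> : (x %% a)%Z = x - Posz a *~ (x %/ a)%Z.
    by rewrite -mulrzr intz mulrC {2}(divz_eq x a) addrAC subrr add0r.
  exact: PB.
apply/dvdz_mod0P; have := modz_ge0 x (lt0r_neq0 (a0 : 0 < Posz a)).
have := ltz_pmod x (a0 : 0 < Posz a).
case: (x %% a)%Z Pr => // -[//|r] Pr; rewrite ltz_nat => ra _.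
have /amin : (0 < r.+1)%N && `[< P (Posz r.+1) >] by apply/asboolP.
by rewrite leqNgt ra.
Qed.

Section Subgroup.
Variables (L : set Z2) (latL : lattice L).

Lemma lattice0 : 0 \in L.
Proof. by case: latL => -[]. Qed.

Lemma latticeB u v : u \in L -> v \in L -> u - v \in L.
Proof. by case: latL => -[_ +] _; apply. Qed.

Lemma latticeN u : u \in L -> - u \in L.
Proof. by rewrite -sub0r; apply: latticeB lattice0. Qed.

Lemma latticeD u v : u \in L -> v \in L -> u + v \in L.
Proof. by move=> uL vL; rewrite -[v]opprK latticeB ?latticeN. Qed.

Lemma latticeMz u k : u \in L -> u *~ k \in L.
Proof.
move=> uL; have nat n : u *+ n \in L.
  by elim: n => [|n IH]; rewrite ?mulr0n ?lattice0 // mulrS latticeD.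
by case: k => n; rewrite ?NegzE ?mulrNz ?latticeN //; apply: nat.
Qed.

Definition coset w := [set w + y | y in L]%classic.

Lemma cosetE u v : coset u = coset v <-> u - v \in L.
Proof.
split=> [E|uvL].
  have : coset u u by exists 0; rewrite ?addr0 //; apply/set_mem/lattice0.
  by rewrite E => -[y /mem_set yL <-]; rewrite addrC addKr.
apply/seteqP; split=> _ [y /mem_set yL <-].
  by exists (u - v + y); [apply/set_mem/latticeD | rewrite addrA addrCA addrN addr0].
exists (v - u + y); last by rewrite addrA addrCA addrN addr0.
by apply/set_mem/latticeD => //; rewrite -opprB latticeN.
Qed.

(** Finitely many cosets force two multiples of [w] into the same one. *)
Lemma lattice_torsion w : exists2 m : nat, (0 < m)%N & w *+ m \in L.
Proof.
apply: contrapT => H; apply: infinite_nat.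
have -> : [set: nat]%classic = ((fun k => coset (w *+ k)) @^-1` cosets L)%classic.
  by apply/seteqP; split=> k //= _; exists (w *+ k).
apply: finite_preimage; last by case: latL.
suff inj k l : (k < l)%N -> coset (w *+ k) <> coset (w *+ l).
  move=> k l _ _ /= E; case: (ltngtP k l) => // kl.
    by case: (inj _ _ kl).
  by case: (inj _ _ kl).
move=> kl /esym/cosetE; rewrite -mulrnBr ?(ltnW kl) // => wL.
by apply: H; exists (l - k)%N; rewrite ?subn_gt0.
Qed.

(** Hermite normal form: [a] generates the first coordinates of [L], and [d] the vertical vectors in
    [L]. *)
Lemma lattice_basis : exists (a d : nat) (b : int),
  [/\ (0 < a)%N, (0 < d)%N, (Posz a, b) \in L, (0, Posz d) \in L &
      forall v, v \in L -> exists k l : int, v = (k * a, k * b + l * d)].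
Proof.
have [|x y [y1 h1] [y2 h2]|a [a0 [b abL] amin]] :=
    @min_multiple (fun x => exists y, (x, y) \in L).
- have [m m0 mL] := lattice_torsion (1, 0); exists m => //; exists 0.
  have <- // : (1, 0) *+ m = (Posz m, 0) :> Z2.
  by apply: Z2_ext; rewrite ?fst_mulrn ?snd_mulrn ?mul1r ?mul0r.
- by exists (y1 - y2); apply: (latticeB h1 h2).
have [|x y h1 h2|d [d0 dL dmin]] := @min_multiple (fun y => (0, y) \in L).
- have [m m0 mL] := lattice_torsion (0, 1); exists m => //.
  have <- // : (0, 1) *+ m = (0, Posz m) :> Z2.
  by apply: Z2_ext; rewrite ?fst_mulrn ?snd_mulrn ?mul1r ?mul0r.
- by have := latticeB h1 h2; rewrite -[X in (X, _)](subr0 0).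
exists a, d, b; split=> // -[x y] vL.
have /dvdzP[k kx] : (a %| x)%Z by apply: amin; exists y.
have /dvdzP[l ly] : (d %| y - k * b)%Z.
  apply: dmin; have -> : (0, y - k * b) = (x, y) - (Posz a, b) *~ k.
    by apply: Z2_ext; rewrite /= ?fst_mulrz ?snd_mulrz /= ?kx; ring.
  by rewrite latticeB ?latticeMz.
by exists k, l; rewrite -kx -ly addrC subrK.
Qed.

(** The integer points of the box [[0, a) x [0, d)] represent each coset exactly once. *)
Lemma lattice_indexE (a d : nat) (b : int) :
  (0 < a)%N -> (0 < d)%N -> (Posz a, b) \in L -> (0, Posz d) \in L ->
  (forall v, v \in L -> exists k l : int, v = (k * a, k * b + l * d)) ->
  lattice_index L = (a * d)%N.
Proof.
move=> a0 d0 abL dL basis.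
pose rep (ij : 'I_a * 'I_d) := coset (Posz ij.1, Posz ij.2).
have repI : injective rep.
  move=> [i j] [i' j'] /cosetE/basis[k [l [/= Ei Ej]]].
  have /eqP k0 : k == 0.
    apply/eqP; have := ltn_ord i; have := ltn_ord i'; nia.
  have l0 : l = 0 by move: Ej; rewrite k0; have := ltn_ord j; have := ltn_ord j'; nia.
  by congr (_, _); apply: val_inj => /=; move: Ei Ej; rewrite k0 l0; lia.
rewrite /lattice_index.
have -> : cosets L = [set` [fset rep x | x in {: 'I_a * 'I_d}]%fset]%classic.
  apply/seteqP; split=> X.
    move=> [[x y] _ <-]; rewrite -/(coset _).
    have remE (m : nat) z : (0 < m)%N ->
        (`|(z %% m)%Z| < m)%N /\ Posz `|(z %% m)%Z| = z - (z %/ m)%Z * m.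
      move=> m0; have r0 := modz_ge0 z (lt0r_neq0 (m0 : 0 < Posz m)).
      split; first by rewrite -ltz_nat gez0_abs ?ltz_pmod.
      by rewrite gez0_abs // [in RHS]divz_eq addrAC subrr add0r.
    (* Reducing [x] modulo [a] by a multiple of [(a, b)] changes the second coordinate to [y'],
       which is then reduced modulo [d]. *)
    have [xa xE] := remE a x a0; pose y' := y - (x %/ a)%Z * b.
    have [yd yE] := remE d y' d0.
    apply/imfsetP; exists (Ordinal xa, Ordinal yd) => //=; apply/cosetE.
    have -> : (x, y) - (Posz `|(x %% a)%Z|, Posz `|(y' %% d)%Z|)
       = (Posz a, b) *~ (x %/ a)%Z + (0, Posz d) *~ (y' %/ d)%Z.
      rewrite xE yE; move: (y' %/ d)%Z => l; rewrite /y'.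
      by apply: Z2_ext; rewrite /= ?fst_mulrz ?snd_mulrz /=; ring.
    by rewrite latticeD ?latticeMz.
  by move=> /imfsetP[ij _ ->]; exists (Posz ij.1, Posz ij.2).
rewrite set_fsetK card_imfset //=.
by rewrite -[LHS]cardE card_prod !card_ord.
Qed.

(** In the basis [(a, b)], [(0, d)] two vectors of [L] have determinant [a * d] times that of their
    coordinates. *)
Lemma lattice_index_facts :
  [/\ (0 < lattice_index L)%N, forall v, v *+ lattice_index L \in L &
      forall u v, u \in L -> v \in L -> (lattice_index L %| det2 u v)%Z].
Proof.
have [a [d [b [a0 d0 abL dL basis]]]] := lattice_basis.
rewrite (lattice_indexE a0 d0 abL dL basis) muln_gt0 a0 d0; split=> // [[x y]|u v].
  have -> : (x, y) *+ (a * d) =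
     (Posz a, b) *~ (x * d) + (0, Posz d) *~ (y * a - x * b).
    apply: Z2_ext; rewrite ?fst_mulrn ?snd_mulrn /= ?fst_mulrz ?snd_mulrz /=;
      rewrite PoszM; ring.
  by rewrite latticeD ?latticeMz.
move=> /basis[k [l ->]] /basis[k' [l' ->]]; apply/dvdzP; exists (k * l' - k' * l).
by rewrite /det2 PoszM /=; ring.
Qed.

End Subgroup.
End Lattice.

(** * Avoiding lattices modulo powers of one prime, and gluing over several primes *)

Lemma pigeonhole_avoid (S : finType) (A : {set S}) (k : nat) (R : nat -> S -> Prop) :
  #|A| < k ->
  (forall s i j, s \in A -> i < j < k -> R i s -> R j s -> False) ->
  exists2 i, i < k & forall s, s \in A -> ~ R i s.
Proof.
move=> Ak uniqR; apply: contrapT => H.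
have ex (i : 'I_k) : exists s, s \in A /\ R i s.
  apply: contrapT => Hi; apply: H; exists i => // s sA Ris; apply: Hi; by exists s.
(* Each candidate [i] is spoiled by some [g i], and no element spoils two, so [g] would embed [k]
   candidates into [A]. *)
have [g gP] := choice ex.
have ginj : injective g.
  move=> i j gij; have [giA Ri] := gP i; have [_ Rj] := gP j; rewrite -gij in Rj.
  apply: val_inj; case: (ltngtP i j) => //= ij.
    by case: (uniqR _ i j giA) => //; rewrite ij ltn_ord.
  by case: (uniqR _ j i giA) => //; rewrite ij ltn_ord.
have := Ak; rewrite ltnNge => /negP; apply.
rewrite -[k in k <= _]card_ord -(card_imset _ ginj); apply: subset_leq_card.
by apply/fintype.subsetP=> _ /imsetP[i _ ->]; case: (gP i).
Qed.

Section Avoid.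
Local Open Scope ring_scope.
Implicit Types (u v w x y z : Z2).

Definition congr2 (q : nat) x y := exists z, y = x + z *+ q.

Lemma congr2_refl q x : congr2 q x x.
Proof. by exists 0; rewrite mul0rn addr0. Qed.

Lemma congr2_trans q x y z : congr2 q x y -> congr2 q y z -> congr2 q x z.
Proof. by move=> [a ->] [b ->]; exists (a + b); rewrite mulrnDl addrA. Qed.

Lemma congr2_dvd q r x y : (q %| r)%N -> congr2 r x y -> congr2 q x y.
Proof. by move=> /dvdnP[k ->] [a ->]; exists (a *+ k); rewrite -mulrnA. Qed.

Definition prime_to (p : nat) v := ~~ ((p %| v.1)%Z && (p %| v.2)%Z).

Lemma prime_to_congr2 p x y : congr2 p x y -> prime_to p y = prime_to p x.
Proof.
move=> [z ->]; rewrite /prime_to /= fst_mulrn snd_mulrn.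
by rewrite !rpredDr ?dvdz_mull.
Qed.

(** The determinant modulo [q] depends only on [u] and [v] modulo [q]. Hence two candidates whose
    determinant is not divisible by [q] cannot both have classes meeting [L]. *)
Lemma dvd_det2 (L : set Z2) q u v w z : lattice L -> (q %| lattice_index L)%N ->
  u + w *+ q \in L -> v + z *+ q \in L -> (q %| det2 u v)%Z.
Proof.
move=> latL qn uL vL; have [_ _ /(_ _ _ uL vL)] := lattice_index_facts latL.
move=> /(dvdz_trans (qn : (Posz q %| Posz (lattice_index L))%Z)).
rewrite /det2 /= !fst_mulrn !snd_mulrn.
set E := (X in (q %| X)%Z); have -> : E = det2 u v +
  (u.1 * z.2 + w.1 * v.2 + w.1 * z.2 * q - u.2 * z.1 - w.2 * v.1 - w.2 * z.1 * q) * q.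
  by rewrite /E /det2; ring.
by rewrite rpredDr ?dvdz_mull.
Qed.

(* At level 0 the candidates are the points of the projective line over F_p. *)
Lemma line_candidates (p j : nat) x : prime p -> prime_to p x ->
  exists c : nat -> Z2, [/\ forall i, prime_to p (c i),
    forall i, congr2 (p ^ j) x (c i) &
    forall i k, (i < k < p + (j == 0))%N -> ~~ (Posz (p ^ j.+1) %| det2 (c i) (c k))%Z].
Proof.
move=> pr_p px; have p1 := prime_gt1 pr_p.
have diff (i k : nat) : (i < k < p)%N -> ~~ (p %| Posz k - Posz i)%Z.
  move=> /andP[ik kp]; rewrite subzn ?(ltnW ik) // dvdzE /=.
  by rewrite gtnNdvd ?subn_gt0 //; apply: leq_ltn_trans kp; apply: leq_subr.
case: j => [|j].
  exists (fun i => if i == p then (0, 1) else (1, Posz i)); split=> [i|i|i k].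
  - by case: ifP; rewrite /prime_to /= dvdz1 /= (gtn_eqF p1) ?andbF.
  - by move: (if _ then _ else _) => y; exists (y - x); rewrite addrC subrK.
  rewrite eqxx addn1 ltnS expn1 => /andP[ik kp]; rewrite (ltn_eqF (leq_trans ik kp)).
  case: eqP => [_|/eqP kNp]; rewrite /det2 /=.
    by rewrite mulr0 mul1r subr0 dvdz1 /= gtn_eqF.
  by rewrite mul1r mulr1 diff // ik ltn_neqAle kNp.
(* At positive levels the candidates move [x] in a direction [u] independent of it modulo [p]; their
   determinants are the modulus times [k - i] times [det2 x u]. *)
have [u pu] : exists u, ~~ (p %| det2 x u)%Z.
  move: px; rewrite /prime_to negb_and => /orP[px|px]; [exists (0, 1) | exists (-1, 0)].
    by rewrite /det2 /= mulr1 mulr0 subr0.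
  by rewrite /det2 /= mulr0 mulrN1 opprK add0r.
have cong i : congr2 (p ^ j.+1) x (x + u *+ i *+ p ^ j.+1) by exists (u *+ i).
exists (fun i => x + u *+ i *+ p ^ j.+1); split=> // [i|i k].
  rewrite (@prime_to_congr2 _ x) //; apply: congr2_dvd (cong i).
  by rewrite expnS dvdn_mulr.
rewrite addn0 => ikp; set D := det2 _ _.
have -> : D = Posz (p ^ j.+1)%N * ((Posz k - Posz i) * det2 x u).
  rewrite /D /det2 /= !fst_mulrn !snd_mulrn; ring.
rewrite [in (p ^ j.+2)%N]expnSr PoszM dvdz_mul2l; last first.
  by rewrite eqz_nat expn_eq0 (gtn_eqF (prime_gt0 pr_p)).
by rewrite dvdzE abszM /= Euclid_dvdM // negb_or pu andbT diff.
Qed.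

Section Family.
Variables (S : finType) (L : S -> set Z2) (latL : forall s, lattice (L s)).

(** By [dvd_det2] each lattice meets the class of at most one candidate, and candidates outnumber
    lattices: [p + 1] against at most [p] at level 0, [p] against at most [p - 1] later. Avoiding a
    whole class leaves the higher digits free. *)
Lemma avoid_level (p j : nat) x (A : {set S}) : prime p -> prime_to p x ->
  (forall s, s \in A -> (p ^ j.+1 %| lattice_index (L s))%N) ->
  (#|A| <= p.-1 + (j == 0))%N ->
  exists y, [/\ prime_to p y, congr2 (p ^ j) x y &
    forall s z, s \in A -> y + z *+ p ^ j.+1 \notin L s].
Proof.
move=> pr_p px An Ap; have [c [cp cx cdet]] := line_candidates j pr_p px.
have Ap' : (#|A| < p + (j == 0))%N.
  by rewrite -(prednK (prime_gt0 pr_p)) addSn ltnS.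
have [|i _ iP] := pigeonhole_avoid (R := fun i s => exists z, c i + z *+ p ^ j.+1 \in L s) Ap'.
  move=> s i k sA ikp [z zL] [z' zL']; have /negP := cdet i k ikp; apply.
  exact: (dvd_det2 (latL s) (An s sA) zL zL').
exists (c i); split=> // s z sA; apply/negP=> zL; apply: (iP s sA); by exists z.
Qed.

(** Digits are chosen level by level. Below [f] there is nothing to avoid, so [x] is kept modulo
    [p ^ f]; later choices stay inside the classes that already avoid the earlier lattices. *)
Lemma avoid_prime (p f : nat) x (lev : S -> nat) (A : {set S}) :
  prime p -> prime_to p x ->
  (forall s, s \in A -> (f <= lev s)%N /\ (p ^ (lev s).+1 %| lattice_index (L s))%N) ->
  (forall j, (#|[set s in A | lev s == j]| <= p.-1 + (j == 0))%N) ->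
  exists y, congr2 (p ^ f) x y /\
    forall s z, s \in A -> y + z *+ p ^ (lev s).+1 \notin L s.
Proof.
move=> pr_p px An Ap.
suff H J : exists y, [/\ prime_to p y, congr2 (p ^ f) x y & forall s z,
    s \in A -> (lev s < J)%N -> y + z *+ p ^ (lev s).+1 \notin L s].
  have [y [_ xy yP]] := H (\max_s lev s).+1; exists y; split=> // s z sA.
  by apply: yP => //; rewrite ltnS leq_bigmax.
elim: J => [|J [y [py xy yP]]]; first by exists x; split=> //; apply: congr2_refl.
have [Jf|fJ] := ltnP J f.
  exists y; split=> // s z sA; rewrite ltnS => sJ; have [fs _] := An s sA.
  by have := leq_trans (leq_ltn_trans sJ Jf) fs; rewrite ltnn.
have [s||y' [py' yy' yP']] := avoid_level (j := J) (A := [set s in A | lev s == J]) pr_p py.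
- by rewrite inE => /andP[/An[_ +] /eqP <-].
- exact: Ap.
exists y'; split=> //.
  exact/(congr2_trans xy)/(congr2_dvd _ yy')/dvdn_exp2l.
move=> s z sA; rewrite ltnS leq_eqVlt => /orP[/eqP sJ|sJ].
  by rewrite sJ; apply: yP'; rewrite inE sA sJ eqxx.
have [w ->] := congr2_dvd (dvdn_exp2l p sJ) yy'.
by rewrite -addrA -mulrnDl; apply: yP.
Qed.

End Family.

Lemma chinese_remainder2 (t : nat) (q : 'I_t -> nat) (x : 'I_t -> Z2) :
  (forall i, (0 < q i)%N) -> (forall i j, i != j -> coprime (q i) (q j)) ->
  exists y, forall i, congr2 (q i) (x i) y.
Proof.
move=> q0 cop; pose Q i := (\prod_(j | j != i) q j)%N.
(* [k * Q i] is 1 modulo [q i] and 0 modulo the other [q j]. *)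
have ex i : exists k l : nat, (k * Q i = l * q i + 1)%N.
  have Q0 : (0 < Q i)%N by rewrite prodn_gt0.
  case: (egcdnP (q i) Q0) => k l E _; exists k, l; rewrite E; congr (_ + _)%N.
  apply/eqP; apply: (big_ind (fun m => coprime m (q i))) => [|a b|j /cop //].
    exact: coprime1n.
  by rewrite coprimeMl => -> ->.
have [k /choice[l kl]] := choice ex.
exists (\sum_i x i *+ (k i * Q i)) => i.
exists (x i *+ l i + \sum_(j | j != i) x j *+ (k j * (Q j %/ q i))).
rewrite (bigD1 i) //= kl mulrnDr mulr1n mulrnDl -mulrnA addrA [x i + _]addrC; congr (_ + _).
rewrite -sumrMnl; apply: eq_bigr => j ji; rewrite -mulrnA -mulnA divnK //.
by rewrite /Q (bigD1 i) ?dvdn_mulr // eq_sym.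
Qed.
End Avoid.

(** * Valuations of least common multiples, sizes of levels, primitive vectors *)

Lemma dvdn_biglcm_seq (I : eqType) (r : seq I) (F : I -> nat) i :
  i \in r -> F i %| \big[lcmn/1]_(j <- r) F j.
Proof. by move=> ir; rewrite (big_rem i ir) /= dvdn_lcml. Qed.

(** The valuation of a least common multiple is the maximum of the valuations. *)
Lemma pfactor_dvd_biglcm (I : eqType) (r : seq I) (F : I -> nat) (p k : nat) :
  prime p -> 0 < k -> (forall i, i \in r -> 0 < F i) ->
  p ^ k %| \big[lcmn/1]_(i <- r) F i -> exists2 i, i \in r & p ^ k %| F i.
Proof.
move=> pr_p k0; elim: r => [|j r IH] F0.
  by rewrite big_nil pfactor_dvdn // logn1 leqNgt k0.
have F0r i : i \in r -> 0 < F i by move=> ir; apply: F0; rewrite inE ir orbT.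
have Fj : 0 < F j by apply: F0; rewrite mem_head.
have lcm0 : 0 < \big[lcmn/1]_(i <- r) F i.
  rewrite big_seq; apply: (big_ind (fun m => 0 < m)) => // a b a0 b0.
  by rewrite lcmn_gt0 a0.
rewrite big_cons pfactor_dvdn ?lcmn_gt0 ?Fj // logn_lcm // leq_max.
rewrite -!pfactor_dvdn // => /orP[dj|/(IH F0r)[i ir di]].
  by exists j; rewrite ?mem_head.
by exists i; rewrite // inE ir orbT.
Qed.

(** The values of [g] lie among the [r] numbers from [j * r + 1] to [j * r + r], together with 0
    when [j = 0], because [0.-1 = 0]. *)
Lemma level_card (r j : nat) (S : finType) (A : {set S}) (g : S -> nat) :
  0 < r -> {in A &, injective g} -> (forall s, s \in A -> (g s).-1 %/ r = j) ->
  #|A| <= r + (j == 0).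
Proof.
move=> r0 ginj gj; rewrite cardE -(size_map g).
rewrite -(size_iota (if j == 0 then 0 else (j * r).+1) (r + (j == 0))).
apply: uniq_leq_size => [|_ /mapP[s + ->]]; rewrite ?map_inj_in_uniq ?enum_uniq //.
  by move=> x y; rewrite !mem_enum; apply: ginj.
rewrite mem_enum mem_iota => /gj gs.
have := divn_eq (g s).-1 r; rewrite gs; have := ltn_pmod (g s).-1 r0.
move: (_ %% _) => m mr; case: eqP => [->|/eqP]; first by rewrite mul0n; lia.
by rewrite -lt0n => j0; have : 0 < j * r by [rewrite muln_gt0 j0]; lia.
Qed.

Section Main.
Local Open Scope ring_scope.
Implicit Types (x y : Z2).

Lemma congr2P (q : nat) x y :
  congr2 q x y <-> (q %| (y - x).1)%Z /\ (q %| (y - x).2)%Z.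
Proof.
split=> [[z ->]|[/dvdzP[a Ea] /dvdzP[b Eb]]].
  by rewrite addrAC subrr add0r fst_mulrn snd_mulrn !dvdz_mull.
exists (a, b); apply: Z2_ext; rewrite /= ?fst_mulrn ?snd_mulrn /=.
  by rewrite -Ea addrC subrK.
by rewrite -Eb addrC subrK.
Qed.

Lemma primitive_divisor x : x != 0 ->
  exists y (k : nat), x = y *+ k /\ forall p, prime p -> prime_to p y.
Proof.
move=> x0; pose g := gcdn `|x.1| `|x.2|.
have g0 : (0 < g)%N.
  rewrite gcdn_gt0 !absz_gt0 -negb_and; apply: contraNN x0 => /andP[/eqP a /eqP b].
  by apply/eqP/Z2_ext.
have /dvdzP[a Ea] : (g %| x.1)%Z by rewrite dvdzE dvdn_gcdl.
have /dvdzP[b Eb] : (g %| x.2)%Z by rewrite dvdzE dvdn_gcdr.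
exists (a, b), g; split; first by apply: Z2_ext; rewrite ?fst_mulrn ?snd_mulrn.
move=> p pr_p; apply/negP=> /andP[/= pa pb].
have : (p * g %| 1 * g)%N.
  by rewrite mul1n {2}/g dvdn_gcd Ea Eb !abszM /= !dvdn_mul.
by rewrite dvdn_pmul2r // dvdn1 (gtn_eqF (prime_gt1 pr_p)).
Qed.
End Main.

(** * Tokens, and a point missed by all lattices *)

Section Tokens.
Variables (t : nat) (p e : 'I_t -> nat).
Hypotheses (hp : forall i, prime (p i)) (pinj : injective p) (he : forall i, 1 <= e i).

(* Token 0 and tokens 1, ..., p - 1 have level 0 because [0.-1 = 0]; afterwards
   each level has p - 1 tokens. *)
Definition token := {i : 'I_t & 'I_(1 + e i * (p i).-1)}.

Definition level (u : token) := (tagged u).-1 %/ (p (tag u)).-1.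

Lemma pred_gt0 i : 0 < (p i).-1.
Proof. by have := prime_gt1 (hp i); case: (p i) => [|[]]. Qed.

Lemma level_lt u : level u < e (tag u).
Proof.
rewrite /level ltn_divLR ?pred_gt0 //; have := ltn_ord (tagged u).
have : 0 < e (tag u) * (p (tag u)).-1 by rewrite muln_gt0 he pred_gt0.
lia.
Qed.

Lemma coprime_pexp i j : i != j -> coprime (p i ^ e i) (p j ^ e j).
Proof.
move=> ij; rewrite coprimeXl // coprimeXr // prime_coprime // dvdn_prime2 //.
by apply: contraNN ij => /eqP/pinj ->.
Qed.

Lemma logn_le_exponent (n : nat) i :
  0 < n -> n %| \prod_(j < t) p j ^ e j -> logn (p i) n <= e i.
Proof.
move=> n0 nN; rewrite -(dvdn_Pexp2l _ _ (prime_gt1 (hp i))).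
have := dvdn_trans (pfactor_dvdnn (p i) n) nN; rewrite (bigD1 i) //= Gauss_dvdl //.
apply: (big_ind (coprime _)) => [|a b|j ji]; first exact: coprimen1.
  by rewrite coprimeMr => -> ->.
by rewrite coprimeXl // coprimeXr // prime_coprime // dvdn_prime2 // (inj_eq pinj) eq_sym.
Qed.

Section Family.
Variables (S : finType) (L : S -> set Z2) (latL : forall s, lattice (L s)).
Hypothesis idxL : forall s, lattice_index (L s) %| \prod_(i < t) p i ^ e i.

Definition tokens (s : S) : {set token} :=
  [set u | level u < logn (p (tag u)) (lattice_index (L s))].

(** For each [i], [x] is kept modulo [p i ^ k i], the largest power of [p i] in an index from [D].
    Lattices matched to tokens of [p i] have level at least [k i], since these tokens are not joined
    to [D], so they are avoided by changing higher digits only. *)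
Lemma uncovered_point (D : {set S}) (f : S -> token) (x : Z2) :
  {in ~: D &, injective f} ->
  {in ~: D, forall s, f s \in tokens s :\: nbhd tokens D} ->
  (forall i, prime_to (p i) x) -> (forall s, s \in D -> x \notin L s) ->
  exists y, forall s, y \notin L s.
Proof.
move=> finj fN px xD; pose n s := lattice_index (L s).
have n0 s : 0 < n s by have [] := lattice_index_facts (latL s).
pose k i := \max_(s in D) logn (p i) (n s).
pose A i := [set s in ~: D | tag (f s) == i].
have Afacts i s : s \in A i -> k i <= level (f s) /\ p i ^ (level (f s)).+1 %| n s.
  rewrite inE => /andP[sD /eqP <-]; have := fN s sD; rewrite inE => /andP[fD fs].
  split; last by rewrite pfactor_dvdn //; move: fs; rewrite inE.
  apply/bigmax_leqP => s' s'D; rewrite leqNgt; apply: contraNN fD => lt.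
  by apply/bigcupP; exists s' => //; rewrite inE.
(* As [f] is injective, a level receives at most as many lattices as it has tokens. *)
have Acard i j : #|[set s in A i | level (f s) == j]| <= (p i).-1 + (j == 0).
  apply: (level_card (g := fun s => val (tagged (f s)))) => [|s s'|s].
  - exact: pred_gt0.
  - rewrite !inE => /andP[/andP[sD /eqP si] _] /andP[/andP[s'D /eqP s'i] _] ff.
    apply: finj; rewrite ?inE //; move: si s'i ff; case: (f s) (f s') => [i1 m1] [i2 m2] /=.
    by move=> i1E i2E; move: m1 m2; rewrite i1E i2E => m1 m2 /val_inj ->.
  - by rewrite !inE => /andP[/andP[_ /eqP <-] /eqP].
have ex i : exists z, congr2 (p i ^ k i) x z /\
    forall s w, s \in A i -> (z + w *+ p i ^ (level (f s)).+1)%R \notin L s.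
  exact: (avoid_prime latL (hp i) (px i) (Afacts i) (Acard i)).
have [z zP] := choice ex.
have [|y yz] := chinese_remainder2 (q := fun i => p i ^ e i) z _ coprime_pexp.
  by move=> i; rewrite expn_gt0 prime_gt0.
exists y => s; have [sD|sD] := boolP (s \in D); last first.
  have [_ zA] := zP (tag (f s)).
  have [w ->] := congr2_dvd (dvdn_exp2l (p (tag (f s))) (level_lt (f s))) (yz (tag (f s))).
  by apply: zA; rewrite !inE sD /=.
(* [L s] contains all multiples of [n s], so membership depends only on the class modulo [n s]. *)
suff [w yE] : congr2 (n s) x y.
  apply: contraNN (xD s sD) => yL; rewrite -[x](addrK (w *+ n s)%R) -yE.
  by apply: latticeB => //; have [_ + _] := lattice_index_facts (latL s); apply.
(* The congruence is checked on each prime part of [n s], passing through [z i]: its exponent is at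
   most [k i] because [s] is in [D], and at most [e i] by [idxL]. *)
have dvd q : q \in \pi(n s) -> congr2 ((n s)`_q) x y.
  rewrite mem_primes => /and3P[pr_q _ qn]; have := dvdn_trans qn (idxL s).
  rewrite Euclid_dvd_prod // big_has => /hasP[i _]; rewrite Euclid_dvdX // => /andP[+ _].
  rewrite dvdn_prime2 // => /eqP ->; rewrite p_part; have [xz _] := zP i.
  apply: (@congr2_trans _ _ (z i)).
    apply: congr2_dvd xz; apply: dvdn_exp2l.
    exact: (bigop.leq_bigmax_cond (P := mem D) (F := fun s => logn (p i) (n s))).
  by apply: congr2_dvd (yz i); apply/dvdn_exp2l/(logn_le_exponent _ (n0 s) (idxL s)).
by apply/congr2P; split; rewrite dvdzE; apply/(dvdn_partP _ (n0 s)) => q /dvd/congr2P[].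
Qed.

End Family.
End Tokens.

Theorem theoremB (C : {fset set Z2}) (t : nat) (p e : 'I_t -> nat)
    (hC : irredundant_covering C)
    (hp : forall i, prime (p i))
    (pinj : injective p)
    (he : forall i, 1 <= e i)
    (hlcm : \big[lcmn/1]_(L <- C) lattice_index L = \prod_(i < t) p i ^ e i) :
  t + 1 + \sum_(i < t) e i * (p i - 1) <= #|` C|%fset.
Proof.
have [[latC covC] irrC] := hC; pose L (s : C) : set Z2 := val s.
have latL s : lattice (L s) by apply: latC; apply: valP.
have idxL s : lattice_index (L s) %| \prod_(i < t) p i ^ e i.
  by rewrite -hlcm dvdn_biglcm_seq //; apply: valP.
pose N := @tokens t p e C L.
(* Some index is divisible by the full power [p i ^ e i], and its lattice is joined to every token
   of [p i]. *)
have Nfull : nbhd N [set: C] = [set: token p e].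
  apply/setP=> u; rewrite !inE; set i := tag u.
  have [||K KC Kd] := @pfactor_dvd_biglcm _ C lattice_index (p i) (e i) (hp i) (he i).
  - by move=> K /latC/lattice_index_facts[].
  - by rewrite hlcm (bigD1 i) //= dvdn_mulr.
  apply/finset.bigcupP; exists [` KC]%fset => //; rewrite inE (leq_trans (level_lt hp he u)) //.
  by rewrite -pfactor_dvdn //; have [] := lattice_index_facts (latC _ KC).
have cardT : #|{: token p e}| = t + \sum_(i < t) e i * (p i - 1).
  rewrite tagnat.card big_split /= sum1_card card_ord; congr (_ + _).
  by apply: eq_bigr => i _; rewrite subn1.
(* The bound is one more than the number of tokens, so its failure leaves at least as many tokens as
   lattices. *)
rewrite addnAC -cardT addn1 cardfE ltnNge; apply/negP => leCT.
have [s0] : exists s0 : C, (0 : Z2)%R \in L s0.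
  have : (\bigcup_(L in [set` C]) L)%classic (0 : Z2)%R by rewrite covC.
  by move=> [K KC K0]; exists [` KC]%fset; apply/mem_set.
move=> s00.
(* A default token, needed because the matching is a total function. *)
have [t0 _] : exists t0 : token p e, t0 \in predT.
  by apply/card_gt0P; apply: leq_trans leCT; apply/card_gt0P; exists s0.
have [|D [f [DnT finj fN]]] := @deficient_set_matching _ _ t0 N s0.
  by rewrite Nfull cardsT.
have [x xD] : exists x, forall s, s \in D -> x \notin L s.
  pose D' := [fset val s | s in D]%fset.
  have D'C : (D' `<` C)%fset.
    rewrite fproperEneq; apply/andP; split; last first.
      by apply/fsubsetP=> _ /imfsetP[s _ ->]; apply: valP.
    apply: contraNneq DnT => D'E; apply/eqP/setP=> s; rewrite inE.
    have : val s \in D' by rewrite D'E; apply: valP.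
    by case/imfsetP=> s' /= s'D /val_inj ->.
  apply: contrapT => H; apply: (irrC _ D'C); split.
    by move=> K /(fsubsetP (fproper_sub D'C))/latC.
  apply/seteqP; split=> // x _; apply: contrapT => xH; apply: H; exists x => s sD.
  apply/negP=> xs; apply: xH; exists (val s); last exact: set_mem.
  by apply/imfsetP; exists s.
have [y [yD py]] : exists y, (forall s, s \in D -> y \notin L s) /\
    forall i, prime_to (p i) y.
  (* Every lattice contains 0, so [x = 0] forces [D] to be empty and any primitive vector will
     do. *)
  have [x0|x0] := eqVneq x 0%R.
    exists (1, 0)%R; split=> [s sD|i].
      by have := xD s sD; rewrite x0 lattice0.
    by rewrite /prime_to /= dvdz1 /= gtn_eqF ?prime_gt1.
  have [y [k [xE py]]] := primitive_divisor x0; exists y; split=> [s sD|i]; last exact: py.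
  by apply: contraNN (xD s sD) => yL; rewrite xE pmulrn latticeMz.
have [z zL] := uncovered_point hp pinj he latL idxL finj fN py yD.
have : (\bigcup_(L in [set` C]) L)%classic z by rewrite covC.
move=> [K KC Kz]; have /negP := zL [` KC]%fset; apply; exact/mem_set.
Qed.
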